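(* Let $k,\ell \ge 1$ be integers and let $\Gamma_0,\Gamma_1,\dots,\Gamma_k$ be finite groups. Then there exists a finite simple graph $G_0$ with $\operatorname{Aut}(G_0)\cong\Gamma_0$ such that \[ \forall i_1\,\exists v_1\,\forall i_2\,\exists v_2\,\cdots\,\forall i_\ell\,\exists v_\ell\;\;\forall j\in\{1,\dots,\ell\}:\quad \operatorname{Aut}(G_0-v_1-\cdots-v_j)\cong\Gamma_{i_j}, \] where each $i_j$ ranges over $\{1,\dots,k\}$ and each $v_j$ ranges over $V(G_0)\setminus\{v_1,\dots,v_{j-1}\}$. Equivalently, in the following game the player has a strategy that always succeeds: the player first constructs a graph $G_0$ with $\operatorname{Aut}(G_0)\cong\Gamma_0$; then in each round $j=1,\dots,\ell$ an adversary selects some $i_j\in\{1,\dots,k\}$ (possibly depending on all previous moves), and the player selects a vertex $v_j\in V(G_{j-1})$ and sets $G_j=G_{j-1}-v_j$, and the player must guarantee $\operatorname{Aut}(G_j)\cong\Gamma_{i_j}$.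
   Context: Graphs are finite, undirected, unlabeled and simple. $\operatorname{Aut}(G)$ denotes the automorphism group of a graph $G$, and $G-v$ denotes the graph obtained from $G$ by deleting the vertex $v$ (and its incident edges). *)

(* Defs.v *)
From HB Require Import structures.
From mathcomp Require Import all_boot all_fingroup.

Set Implicit Arguments.
Unset Strict Implicit.
Unset Printing Implicit Defensive.

Record sgraph := SGraph {
  vertex :> finType;
  adj : rel vertex;
  adj_sym : symmetric adj;
  adj_irrefl : irreflexive adj }.

Definition graph_aut (G : sgraph) : {set {perm G}} :=
  [set s : {perm G} | [forall x, forall y, adj (s x) (s y) == adj x y]].

Lemma graph_autP (G : sgraph) (s : {perm G}) :
  reflect (forall x y, adj (s x) (s y) = adj x y) (s \in graph_aut G).
Proof.
rewrite inE; apply: (iffP forallP) => [H x y | H x].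
  by have /forallP/(_ y)/eqP := H x.
by apply/forallP => y; apply/eqP.
Qed.

Lemma graph_aut_group_set (G : sgraph) : group_set (graph_aut G).
Proof.
apply/group_setP; split=> [|s t /graph_autP Hs /graph_autP Ht].
  by apply/graph_autP => x y; rewrite !perm1.
by apply/graph_autP => x y; rewrite !permM Ht Hs.
Qed.

Canonical graph_aut_group (G : sgraph) : {group {perm G}} :=
  Group (graph_aut_group_set G).

Section DeleteVertex.

Variables (G : sgraph) (v : G).

Definition del_adj : rel {x : G | x != v} :=
  fun x y => adj (val x) (val y).

Lemma del_adj_sym : symmetric del_adj.
Proof. by move=> x y; apply: adj_sym. Qed.

Lemma del_adj_irrefl : irreflexive del_adj.
Proof. by move=> x; apply: adj_irrefl. Qed.

Definition del_vertex : sgraph := SGraph del_adj_sym del_adj_irrefl.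

End DeleteVertex.

(* [rounds l G P] is the quantifier prefix
     forall i_1, exists v_1, ..., forall i_l, exists v_l,
       P [:: (i_1, G_1); ...; (i_l, G_l)],
   where G_0 = G, v_j is a vertex of G_(j-1) and G_j = G_(j-1) - v_j.
   Since the vertices of G_(j-1) are those of G other than v_1, ..., v_(j-1),
   the choices of the v_j are automatically distinct. *)
Fixpoint rounds (I : Type) (l : nat) (G : sgraph)
    (P : seq (I * sgraph) -> Prop) : Prop :=
  if l is l'.+1 then
    forall i : I, exists v : G,
      rounds l' (del_vertex v) (fun h => P ((i, del_vertex v) :: h))
  else P [::].

(* Main.v *)
(* Induction on the number of rounds.  Given winning graphs H_1, ..., H_k for
   one round less, with Aut H_i = Gamma_i, take a graph S with Aut S = Gamma_0
   in which Gamma_0 acts simply transitively on each of k orbits of "hooks",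
   and hang at the hook (a, i), through a connecting vertex, a copy of H_i
   attached at a vertex with trivial stabilizer.  The result still has group
   Gamma_0, and deleting the connecting vertex of (1, i) leaves H_i as a
   separate piece, while the rest is connected, larger than H_i, and
   asymmetric, since only the identity of Gamma_0 fixes the damaged hook.
   From then on the game is played inside H_i. *)
Require Import Defs.
From HB Require Import structures.
From mathcomp Require Import all_boot all_fingroup.

Set Implicit Arguments.
Unset Strict Implicit.
Unset Printing Implicit Defensive.

(** * Embeddings, connectedness, rigidity and degrees *)

Definition embedding (G H : sgraph) (f : G -> H) :=
  injective f /\ forall x y, adj (f x) (f y) = adj x y.

(** Phrased without paths, in the form in which it is applied: to predicates telling on which side
    the image of a vertex lies. *)
Definition connected (G : sgraph) :=
  forall P : pred G, (forall x y, adj x y -> P x = P y) ->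
  forall x y, P x = P y.

(** On a finite graph every self-embedding is an automorphism; plain functions are easier to build
    than permutations. *)
Definition rigid (G : sgraph) := forall f : G -> G, embedding f -> f =1 id.

Definition rigid_at (G : sgraph) (v : G) :=
  forall f : G -> G, embedding f -> f v = v -> f =1 id.

Definition deg (G : sgraph) (x : G) := \sum_(y : G) adj x y.

Lemma embedding_perm (G : sgraph) (s : {perm G}) :
  s \in graph_aut G -> embedding s.
Proof. by move/graph_autP=> sP; split=> //; apply: perm_inj. Qed.

Lemma perm_embedding (G : sgraph) (f : G -> G) (fP : embedding f) :
  perm fP.1 \in graph_aut G.
Proof. by apply/graph_autP=> x y; rewrite !permE fP.2. Qed.

Lemma leq_deg (G H : sgraph) (f : G -> H) x :
  embedding f -> deg x <= deg (f x).
Proof.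
case=> f_inj f_adj; rewrite /deg (eq_bigr (fun y => adj (f x) (f y) : nat)); last first.
  by move=> y _; rewrite f_adj.
have <-: \sum_(z in f @: [set: G]) adj (f x) z = \sum_(y : G) adj (f x) (f y).
  by rewrite big_imset => [|y z _ _ /f_inj //]; apply: eq_bigl => y; rewrite inE.
by rewrite [leqRHS](bigID (mem (f @: [set: G]))) /= leq_addr.
Qed.

Lemma deg_embedding (G : sgraph) (f : G -> G) x : embedding f -> deg (f x) = deg x.
Proof.
case=> f_inj f_adj; rewrite /deg (reindex_inj f_inj).
by apply: eq_bigr => y _; rewrite f_adj.
Qed.

Lemma isog_of_morph (gT rT : finGroupType) (D : {group gT}) (E : {group rT})
    (f : gT -> rT) :
  {in D &, {morph f : x y / (x * y)%g}} -> {in D &, injective f} ->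
  f @: D = E -> D \isog E.
Proof.
move=> fM f_inj fD; apply/isogP; exists (Morphism fM); first exact/injmP.
by rewrite morphimEdom.
Qed.

Lemma graph_aut_isog (G : sgraph) (gT : finGroupType) (t : gT -> G -> G) (v : G) :
  (forall g, embedding (t g)) ->
  (forall g h x, t (g * h)%g x = t g (t h x)) ->
  (forall f, embedding f -> exists g, f =1 t g) ->
  (forall g, t g v = v -> g = 1%g) ->
  graph_aut G \isog [set: gT].
Proof.
move=> tE tM t_onto t_free.
have t1 x : t 1%g x = x.
  by apply: (tE 1%g).1; rewrite -tM mulg1.
(* A product of permutations applies its left factor first, so the inverse turns the left action [t]
   into a homomorphism. *)
pose f g := perm (tE g^-1)%g.1.
rewrite isog_sym; apply: (@isog_of_morph _ _ [group of [set: gT]] [group of graph_aut G] f).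
- by move=> g h _ _; apply/permP=> x; rewrite permM !permE invMg tM.
- move=> g h _ _ /permP/(_ v); rewrite !permE => gh.
  apply/eqP; rewrite eq_mulgV1; apply/eqP/t_free; rewrite tM.
  by rewrite -gh -tM mulgV t1.
apply/setP=> s; apply/imsetP/idP => [[g _ ->]|/embedding_perm/t_onto[g sg]].
  exact: perm_embedding.
by exists g^-1%g; rewrite ?inE //; apply/permP=> x; rewrite permE invgK sg.
Qed.

(** * Disjoint unions with a rigid component *)

Definition splits (F H K : sgraph) := exists phi : F + H -> K,
  bijective phi /\ forall u v, adj (phi u) (phi v) =
    match u, v with
    | inl x, inl y => adj x y
    | inr x, inr y => adj x y
    | _, _ => false
    end.

(** An automorphism of [K] sends the connected [F] wholly to one side. [H] is too small to hold it,
    so [F] is preserved, hence fixed pointwise by rigidity, and only an automorphism of [H]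
    remains. *)
Lemma splits_graph_aut (F H K : sgraph) :
  splits F H K -> connected F -> rigid F -> #|H| < #|F| ->
  graph_aut H \isog graph_aut K.
Proof.
case=> phi [[psi phiK psiK] phi_adj] Fconn Frig leHF.
pose ext (s : {perm H}) (z : K) :=
  phi (match psi z with inl x => inl x | inr y => inr (s y) end).
have ext_inj s : injective (ext s).
  move=> z w /(can_inj phiK); case Ez: (psi z) => [x|x]; case Ew: (psi w) => [y|y] //.
    by case=> xy; apply: (can_inj psiK); rewrite Ez Ew xy.
  by case=> /perm_inj xy; apply: (can_inj psiK); rewrite Ez Ew xy.
pose f s := perm (@ext_inj s).
have fE s z : f s (phi z) = phi (match z with inl x => inl x | inr y => inr (s y) end).
  by rewrite permE /ext phiK.
apply: (@isog_of_morph _ _ _ _ f).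
- move=> s t _ _; apply/permP=> z; rewrite -(psiK z) permM !fE.
  by case: (psi z) => // y; rewrite permM.
- move=> s t _ _ /permP st; apply/permP=> y.
  by have := st (phi (inr y)); rewrite !fE => /(can_inj phiK)[].
apply/setP=> t; apply/imsetP/idP => [[s /graph_autP sA ->]|/embedding_perm[t_inj t_adj]].
  apply/graph_autP=> z w; rewrite -(psiK z) -(psiK w) !fE !phi_adj.
  by case: (psi z) => x; case: (psi w) => y.
pose inF z := if psi z is inl _ then true else false.
have tF x : inF (t (phi (inl x))).
  pose P x := inF (t (phi (inl x))).
  have Pc y : P x = P y.
    apply: Fconn => {}x {}y xy; move: (t_adj (phi (inl x)) (phi (inl y))).
    rewrite phi_adj xy /P /inF -(psiK (t _)) -(psiK (t (phi (inl y)))) phi_adj !psiK.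
    by case: (psi (t _)) => ?; case: (psi (t _)).
  apply: contraT => /negbTE nPx.
  have sub : {subset codom (fun x => psi (t (phi (inl x)))) <= codom (@inr F H)}.
    move=> _ /codomP[y ->]; move: (Pc y); rewrite /P nPx /inF.
    by case: (psi _) => // z _; apply: codom_f.
  move/subsetP/subset_leq_card: sub; rewrite !card_codom; first by rewrite leqNgt leHF.
    by move=> y z [].
  by move=> y z /(can_inj psiK)/t_inj/(can_inj phiK)[].
(* The default [x] is never reached, by [tF]; nor is the default of [h] below, by [hE]. *)
pose f0 x := if psi (t (phi (inl x))) is inl y then y else x.
have f0E x : t (phi (inl x)) = phi (inl (f0 x)).
  rewrite -(psiK (t _)) /f0; move: (tF x); rewrite /inF.
  by case: (psi (t (phi (inl x)))).
have {f0E}tl x : t (phi (inl x)) = phi (inl x).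
  suff f0_id : f0 =1 id by rewrite f0E f0_id.
  apply: Frig; split=> [y z yz|y z].
    have: t (phi (inl y)) = t (phi (inl z)) by rewrite !f0E yz.
    by move/t_inj/(can_inj phiK)=> [].
  by have := t_adj (phi (inl y)) (phi (inl z)); rewrite !f0E !phi_adj.
pose h y := if psi (t (phi (inr y))) is inr z then z else y.
have hE y : t (phi (inr y)) = phi (inr (h y)).
  rewrite -(psiK (t _)) /h; case E: (psi (t (phi (inr y)))) => [x|//].
  have: t (phi (inr y)) = t (phi (inl x)) by rewrite tl -E psiK.
  by move/t_inj/(can_inj phiK).
have hP : embedding h.
  split=> [y z yz|y z].
    have: t (phi (inr y)) = t (phi (inr z)) by rewrite !hE yz.
    by move/t_inj/(can_inj phiK)=> [].
  by have := t_adj (phi (inr y)) (phi (inr z)); rewrite !hE !phi_adj.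
exists (perm hP.1); first exact: perm_embedding.
apply/permP=> z; rewrite -(psiK z) fE; case: (psi z) => [x|y]; first by rewrite tl.
by rewrite permE hE.
Qed.

Lemma card_del_vertex (G : sgraph) (v : G) : #|del_vertex v| < #|G|.
Proof.
by rewrite card_sig -[#|G|](cardC (pred1 v)) card1 add1n ltnS; apply/subset_leq_card/subsetP.
Qed.

Lemma splits_del_vertex (F H K : sgraph) (v : H) :
  splits F H K -> exists w : K, splits F (del_vertex v) (del_vertex w).
Proof.
case=> phi [[psi phiK psiK] phi_adj]; exists (phi (inr v)).
have ne (z : F + {y : H | y != v}) :
    phi (match z with inl x => inl x | inr y => inr (val y) end) != phi (inr v).
  by rewrite (can_eq phiK); case: z => // -[].
exists (fun z => exist (fun w => w != phi (inr v)) _ (ne z)); split; last first.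
  by case=> x [] y; rewrite /= /del_adj /= phi_adj.
apply: inj_card_bij => [[x|[x xv]] [y|[y yv]] /(congr1 val) /(can_inj phiK)|] //=.
- by case=> ->.
- by case=> xy; congr inr; apply: val_inj.
rewrite card_sum !card_sig.
have := bij_eq_card (Bijective phiK psiK); rewrite card_sum => FHK.
have cP (T : finType) (x : T) : #|T| = #|[pred y | y != x]|.+1.
  by rewrite -(cardC (pred1 x)) card1 add1n.
by rewrite -ltnS -addnS -!cP -FHK.
Qed.

(** * The game and the transfer of strategies *)

Section Game.

Variables (k : nat) (Gamma : 'I_k -> finGroupType).

(** Tests each group as soon as its vertex is deleted, so that inductions on [l] need not carry the
    history predicate of [rounds]. *)
Fixpoint winning (l : nat) (G : sgraph) : Prop :=
  if l is l'.+1 then forall i, exists2 v : G,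
    graph_aut (del_vertex v) \isog [set: Gamma i] & winning l' (del_vertex v)
  else True.

Lemma rounds_impl (I : Type) l (G : sgraph) (P Q : seq (I * sgraph) -> Prop) :
  (forall h, P h -> Q h) -> rounds l G P -> rounds l G Q.
Proof.
elim: l G P Q => [|l IHl] G P Q PQ; first exact: PQ.
move=> GP i; have [v vP] := GP i; exists v; apply: IHl vP => h; exact: PQ.
Qed.

Lemma winning_rounds l (G : sgraph) : winning l G ->
  rounds l G (fun h : seq ('I_k * sgraph) =>
    all (fun p => graph_aut p.2 \isog [set: Gamma p.1]) h).
Proof.
elim: l G => [|l IHl] G //= Gw i; have [v vi vw] := Gw i; exists v.
by apply: rounds_impl (IHl _ vw) => h hP; rewrite /= vi.
Qed.

(** The moves of [H] are copied in [K]. They only shrink [H], so [F] stays larger and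
    [splits_graph_aut] applies in every round. *)
Lemma splits_winning (F : sgraph) : connected F -> rigid F ->
  forall l (H K : sgraph), splits F H K -> #|H| < #|F| ->
  winning l H -> winning l K.
Proof.
move=> Fconn Frig; elim=> [|l IHl] H K //= HK leHF Hw i.
have [v vi vw] := Hw i; have [w sw] := splits_del_vertex v HK.
have lt_v := ltn_trans (card_del_vertex v) leHF.
exists w; last exact: IHl sw lt_v vw.
by rewrite -(isog_transl _ (splits_graph_aut sw Fconn Frig lt_v)).
Qed.

End Game.

(** * Scaffolds and their construction as voltage covers *)

(* The threshold [sc_deg] is arbitrarily large (see [scaffold_exists]), which
   makes the vertices of the scaffold recognizable, after graphs of smaller
   degree are attached to its hooks, as those of degree at least [sc_deg] and
   their neighbours.  The hooks stay below it when they receive an edge. *)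
Record scaffold (gT : finGroupType) (k : nat) := Scaffold {
  sc_graph :> sgraph;
  sc_act : gT -> sc_graph -> sc_graph;
  sc_hook : gT -> 'I_k -> sc_graph;
  sc_deg : nat;
  sc_act_emb : forall g, embedding (sc_act g);
  sc_actM : forall g h x, sc_act (g * h)%g x = sc_act g (sc_act h x);
  sc_emb_act : forall f, embedding f -> exists g, f =1 sc_act g;
  sc_hook_inj : forall a i b j, sc_hook a i = sc_hook b j -> a = b /\ i = j;
  sc_act_hook : forall g a i, sc_act g (sc_hook a i) = sc_hook (g * a)%g i;
  sc_hook_low : forall a i, (deg (sc_hook a i)).+1 < sc_deg;
  sc_low_near : forall x : sc_graph, deg x < sc_deg ->
    exists2 y, adj x y & sc_deg <= deg y;
  sc_conn : connected sc_graph }.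

Section VoltageScaffold.

Variables (gT : finGroupType) (m : nat).

(* The sets [shade p] are chosen to be pairwise distinct and such that [q] lies
   in exactly [q.+1] of them. *)
Definition shade (p q : nat) :=
  match p with 0 => q != 1 | 1 => q == 1 | p'.+2 => p' < q end.

(** Layers [2, 3, ...] receive the elements of [enum gT] in turn, whence [q - 2]; further layers are
    padded with [1%g]. *)
Definition voltage (p q : nat) : gT :=
  if p == 1 then nth 1%g (enum gT) (q - 2) else 1%g.

(* The vertices [(a, inl q)] form the voltage cover of a complete graph: layers
   [1] and [q > 1] are joined by the matching a |-> a g, with g running over the
   whole group, and all other pairs by the identity matching.  Each vertex
   [(a, inr p)] is joined to the [(a, inl q)] with [q] in [shade p]; this makes
   the degree [m.+3 + q] determine the layer [q], and exceed all other degrees. *)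
Definition volt_adj (x y : gT * ('I_m.+3 + 'I_m.+4)) : bool :=
  match x, y with
  | (a, inl p), (b, inl q) =>
      if p < q then b == (a * voltage p q)%g
      else if q < p then a == (b * voltage q p)%g else false
  | (a, inl q), (b, inr p) => (a == b) && shade p q
  | (a, inr p), (b, inl q) => (a == b) && shade p q
  | (a, inr p), (b, inr q) => false
  end.

Lemma volt_adj_sym : symmetric volt_adj.
Proof.
by case=> a [p|p] [b [q|q]] //=; [case: ltngtP|rewrite eq_sym..].
Qed.

Lemma volt_adj_irrefl : irreflexive volt_adj.
Proof. by case=> a [p|p] //=; rewrite ltnn. Qed.

Definition volt_graph := SGraph volt_adj_sym volt_adj_irrefl.

Lemma sum_eq1 (T : finType) (c : T) : \sum_(b : T) (b == c) = 1.
Proof. by rewrite (bigD1 c) //= eqxx big1 // => b /negbTE->. Qed.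

Lemma sum_ltn_ord n q : q <= n -> \sum_(p < n) (p < q) = q.
Proof.
elim: n q => [|n IHn] q; first by rewrite leqn0 big_ord0 => /eqP.
case: q => [|q] leqn; first by rewrite big1.
by rewrite big_ord_recl /= -[in RHS](IHn q).
Qed.

Lemma deg_volt (x : volt_graph) :
  deg x = match x with
          | (a, inl q) => m.+3 + q
          | (a, inr p) => \sum_(q < m.+3) shade p q
          end.
Proof.
rewrite /deg; case: x => a x /=.
transitivity (\sum_(b : gT) \sum_y (volt_adj (a, x) (b, y) : nat)).
  by rewrite pair_bigA; apply: eq_bigr => -[].
rewrite exchange_big big_sumType /=; case: x => [q|p] /=; last first.
  rewrite [X in _ + X]big1 ?addn0 => [|q _]; last by rewrite big1.
  apply: eq_bigr => q _; under eq_bigr => b _ do rewrite eq_sym -mulnb.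
  by rewrite -big_distrl /= sum_eq1 mul1n.
(* There is one neighbour in each of the [m.+2] other layers. *)
have ->: \sum_(p < m.+3) \sum_(b : gT) (if q < p then b == (a * voltage q p)%g
    else if p < q then a == (b * voltage p q)%g else false) = m.+2.
  transitivity (\sum_(p < m.+3) (p != q)).
    apply: eq_bigr => p _; rewrite neq_ltn; case: ltngtP => pq.
    - exact: sum_eq1.
    - rewrite -[RHS](sum_eq1 a) [RHS](reindex_inj (mulIg (voltage p q))).
      by apply: eq_bigr => b _; rewrite eq_sym.
    - exact: big1.
  by rewrite -big_mkcond sum1_card cardC1 card_ord.
transitivity (m.+2 + \sum_(p < m.+4) shade p q).
  congr (_ + _); apply: eq_bigr => p _.
  under eq_bigr => b _ do rewrite eq_sym -mulnb.
  by rewrite -big_distrl /= sum_eq1 mul1n.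
rewrite 2!big_ord_recl /= sum_ltn_ord; last by rewrite -ltnS.
by case: (_ == 1); rewrite /= !add0n add1n addnS.
Qed.

(** Every set [shade p] misses [0] or [1]. *)
Lemma deg_low p : \sum_(q < m.+3) shade p q < m.+3.
Proof.
rewrite 2!big_ord_recl /= ltnS addnA.
have: shade p 0 + shade p 1 <= 1 by case: p => [|[|[|p]]].
move=> /leq_add; apply; rewrite -[leqRHS]card_ord -sum1_card.
by apply: leq_sum => q _; apply: leq_b1.
Qed.

(** From [p = 3] on, [shade p] misses both [0] and [1], which leaves room for the edge to a
    connecting vertex. *)
Lemma deg_hook p : 2 < p -> (\sum_(q < m.+3) shade p q).+1 < m.+3.
Proof.
case: p => [|[|[|p]]] // _; rewrite 2!big_ord_recl /= !ltnS add0n.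
by rewrite -[leqRHS]card_ord -sum1_card; apply: leq_sum => q _; apply: leq_b1.
Qed.

Lemma shade_neq0 (p : 'I_m.+4) : exists q : 'I_m.+3, shade p q.
Proof.
case: p => [[|[|p]] lt_p]; [by exists ord0|by exists (inord 1); rewrite /= inordK|].
by exists ord_max.
Qed.

Lemma shade_inj (p p' : 'I_m.+4) :
  (forall q : 'I_m.+3, shade p q = shade p' q) -> p = p'.
Proof.
move=> pp'; apply: val_inj.
have {}pp' q : q < m.+3 -> shade p q = shade p' q.
  by move=> lt_q; have:= pp' (Ordinal lt_q).
(* Testing at [0], [1], [2] separates the indices [0] and [1] from all others; the remaining sets
   are thresholds, compared just above each threshold. *)
have pp0 := pp' 0 isT; have pp1 := pp' 1 isT; have pp2 := pp' 2 isT.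
move: pp0 pp1 pp2 pp'; case: p => [[|[|p]] lt_p]; case: p' => [[|[|p']] lt_p'] //=.
- by case: p' lt_p' => [|[|p']].
- by case: p lt_p => [|[|p]].
move=> _ _ _ pp'; congr _.+2; apply/eqP; rewrite eqn_leq -ltnS.
by rewrite (pp' p'.+1) // ltnSn -ltnS -(pp' p.+1) // ltnSn.
Qed.

Definition volt_act (g : gT) (x : volt_graph) : volt_graph := ((g * x.1)%g, x.2).

Lemma volt_act_emb g : embedding (volt_act g).
Proof.
split=> [[a x] [b y] [] /mulgI-> -> //|[a [p|p]] [b [q|q]]] //=;
  by rewrite -?mulgA !(can_eq (mulKg g)).
Qed.

Hypothesis leqm : #|gT| <= m.

Lemma voltage1_onto g : exists q : 'I_m.+3, 1 < q /\ voltage 1 q = g.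
Proof.
have lt_g : index g (enum gT) < m.
  by apply: leq_trans leqm; rewrite cardE index_mem mem_enum.
exists (inord (index g (enum gT)).+2); rewrite inordK; last by rewrite !ltnS ltnW.
split=> //.
by rewrite /voltage /= subSS subn1 /= nth_index ?mem_enum.
Qed.

(** Degrees force [f] to preserve layers, and the identity matchings force the same map [s] on each.
    The matchings from layer [1] make [s] commute with all right multiplications, so it is a left
    multiplication. The vertices [(a, inr p)] are determined by their neighbours. *)
Lemma volt_emb_act (f : volt_graph -> volt_graph) :
  embedding f -> exists g, f =1 volt_act g.
Proof.
move=> fE; have [_ f_adj] := fE; pose s q a := (f (a, inl q)).1.
have fU a q : f (a, inl q) = (s q a, inl q).
  rewrite /s; have := @deg_embedding volt_graph f (a, inl q) fE; rewrite !deg_volt.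
  case: (f _) => b [p /addnI/ord_inj-> //|p /= E].
  by have := deg_low p; rewrite E ltnNge leq_addr.
have s0 a q : s q a = s ord0 a.
  case: (posnP q) => [q0|q_gt0]; first by congr s; apply: val_inj.
  have := f_adj (a, inl ord0) (a, inl q); rewrite !fU /= q_gt0.
  by rewrite /voltage !mulg1 eqxx => /eqP.
have sM a g : s ord0 (a * g)%g = (s ord0 a * g)%g.
  have [q [q_gt1 <-]] := voltage1_onto g.
  have := f_adj (a, inl (inord 1)) ((a * voltage 1 q)%g, inl q).
  by rewrite !fU /= inordK // q_gt1 eqxx !s0 => /eqP.
exists (s ord0 1%g) => -[a [q|p]]; first by rewrite /volt_act fU s0 -sM mul1g.
case E: (f (a, inr p)) => [b [q|p']].
  have := @deg_embedding volt_graph f (a, inr p) fE; rewrite !deg_volt E => /= E'.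
  by have := deg_low p; rewrite -E' ltnNge leq_addr.
have sh (q : 'I_m.+3) : (s ord0 a == b) && shade p' q = shade p q.
  by have := f_adj (a, inl q) (a, inr p); rewrite fU E /= s0 eqxx andTb.
have [q pq] := shade_neq0 p; have := sh q; rewrite pq => /andP[/eqP sb _].
rewrite /volt_act /= -sM mul1g sb; congr (_, inr _); apply: shade_inj => r.
by rewrite -sh sb eqxx.
Qed.

Lemma volt_conn : connected volt_graph.
Proof.
move=> P Padj.
have Pq a q : P (a, inl q) = P (a, inl ord0).
  case: (posnP q) => [q0|q_gt0]; first by congr (P (_, inl _)); apply: val_inj.
  by apply/esym/Padj; rewrite /= q_gt0 /voltage mulg1.
have P1 g : P (g, inl ord0) = P (1%g, inl ord0).
  have [q [q_gt1 <-]] := voltage1_onto g.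
  rewrite -(Pq _ q) -(Pq 1%g (inord 1)); apply/esym/Padj.
  by rewrite /= inordK // q_gt1 mul1g.
suff P0 x : P x = P (1%g, inl ord0) by move=> x y; rewrite !P0.
case: x => a [q|p]; first by rewrite Pq P1.
have [q pq] := shade_neq0 p; rewrite -(P1 a) -(Pq a q).
by apply: Padj; rewrite /= eqxx.
Qed.

End VoltageScaffold.

Lemma scaffold_exists (gT : finGroupType) (k d : nat) :
  exists S : scaffold gT k, d <= sc_deg S.
Proof.
(* The summands provide for the threshold, the [k] hooks and the voltages. *)
pose m := d + k + #|gT|.
have leqm : #|gT| <= m by apply: leq_addl.
have hookP (i : 'I_k) : i.+3 < m.+4.
  by rewrite !ltnS ltnW // (leq_trans (ltn_ord i)) // /m addnAC leq_addl.
(* The shift by [3] meets the condition [2 < p] of [deg_hook]. *)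
pose hook a i : volt_graph gT m := (a, inr (inord i.+3)).
unshelve eexists (@Scaffold gT k (volt_graph gT m) (@volt_act gT m) hook m.+3
  (@volt_act_emb gT m) _ (@volt_emb_act gT m leqm) _ _ _ _ (@volt_conn gT m leqm)).
- by move=> g h x; rewrite /volt_act /= mulgA.
- move=> a i b j [-> /(congr1 val)]; rewrite /= !inordK // => -[].
  by move/val_inj.
- by [].
- by move=> a i; rewrite deg_volt deg_hook // inordK.
- case=> a [q|p]; rewrite deg_volt; first by rewrite ltnNge leq_addr.
  by have [q pq] := shade_neq0 p; exists (a, inl q); rewrite ?deg_volt ?leq_addr //= eqxx.
- by rewrite /= /m -addnA -!addnS leq_addr.
Qed.

(** * Hanging graphs at the hooks of a scaffold *)

Section Hanging.

Variables (gT : finGroupType) (k : nat) (S : scaffold gT k).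
Variables (H : 'I_k -> sgraph) (root : forall i, H i).

Definition bunch := ('I_k + {i : 'I_k & H i})%type.

Definition bunch_adj (z w : bunch) : bool :=
  match z, w with
  | inl i, inr h | inr h, inl i => h == Tagged H (root i)
  | inr h, inr h' => (tag h == tag h') && adj (tagged h) (tagged_as h h')
  | inl _, inl _ => false
  end.

(* In [inr (a, z)], [z = inl i] is the connecting vertex of the hook [(a, i)]
   and [z = inr h] a vertex of the copy of [H (tag h)] behind it. *)
Definition hang_adj (y y' : S + gT * bunch) : bool :=
  match y, y' with
  | inl x, inl x' => adj x x'
  | inl x, inr (a, inl i) | inr (a, inl i), inl x => x == sc_hook S a i
  | inr (a, z), inr (b, w) => (a == b) && bunch_adj z w
  | _, _ => false
  end.

Lemma bunch_adj_sym : symmetric bunch_adj.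
Proof.
case=> [i|[i x]] [j|[j y]] //=; rewrite eq_sym; case: eqP => //= ij; subst j.
by rewrite !tagged_asE adj_sym.
Qed.

Lemma hang_adj_sym : symmetric hang_adj.
Proof.
case=> [x|[a z]] [y|[b w]] /=; first exact: adj_sym.
- by case: w.
- by case: z.
by rewrite eq_sym bunch_adj_sym; case: z; case: w.
Qed.

Lemma hang_adj_irrefl : irreflexive hang_adj.
Proof.
case=> [x|[a [i|[i x]]]] /=; first exact: adj_irrefl.
  by rewrite andbF.
by rewrite tagged_asE adj_irrefl !andbF.
Qed.

Definition hang := SGraph hang_adj_sym hang_adj_irrefl.

Definition hang_act (g : gT) (y : hang) : hang :=
  match y with
  | inl x => inl (sc_act g x)
  | inr (a, z) => inr ((g * a)%g, z)
  end.

Lemma hang_actM g h y : hang_act (g * h)%g y = hang_act g (hang_act h y).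
Proof. by case: y => [x|[a z]] /=; rewrite ?sc_actM ?mulgA. Qed.

Lemma hang_act_emb g : embedding (hang_act g).
Proof.
have [g_inj g_adj] := sc_act_emb S g.
have hookE x a i : (sc_act g x == sc_hook S (g * a)%g i) = (x == sc_hook S a i).
  by rewrite -sc_act_hook (inj_eq g_inj).
split.
  by case=> [x|[a z]] [y|[b w]] //= []; [move/g_inj->|move/mulgI=> -> ->].
case=> [x|[a [i|h]]] [y|[b [j|h']]] //=; rewrite ?(inj_eq (mulgI g)) //.
Qed.

Definition present (B : gT -> 'I_k -> bool) (y : hang) : bool :=
  match y with
  | inl _ => true
  | inr (a, inl i) => B a i
  | inr (a, inr h) => B a (tag h)
  end.

Hypothesis H_conn : forall i, connected (H i).
Hypothesis root_rigid : forall i, rigid_at (root i).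
Hypothesis deg_big : (k + #|{: {i : 'I_k & H i}}|).+1 < sc_deg S.

Lemma deg_bunch a z : @deg hang (inr (a, z)) < sc_deg S.
Proof.
apply: leq_ltn_trans deg_big; rewrite /deg big_sumType /= -add1n; apply: leq_add.
  case: z => [i|h]; last by rewrite big1.
  by rewrite sum_eq1.
apply: (@leq_trans (\sum_(b : gT) \sum_(w : bunch) (b == a))).
  rewrite pair_bigA /=; apply: leq_sum => -[b w] _ /=.
  rewrite [b == a]eq_sym; case: z => [i|h]; case: w => [j|h'];
    by case: (a == b); rewrite //= leq_b1.
rewrite exchange_big /= (eq_bigr (fun=> 1)) => [|w _]; last exact: sum_eq1.
by rewrite sum1_card card_sum card_ord.
Qed.

(** Only hooks gain neighbours, one each, and [sc_hook_low] allows for it. *)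
Lemma deg_scaffold (x : S) : deg x < sc_deg S -> @deg hang (inl x) < sc_deg S.
Proof.
move=> low_x; rewrite /deg big_sumType /=.
have [[b j] /= /eqP Ex|not_hook] := pickP [pred p : gT * 'I_k | x == sc_hook S p.1 p.2].
  apply: leq_ltn_trans (sc_hook_low S b j); rewrite -Ex -addn1 leq_add2l.
  rewrite -[leqRHS](sum_eq1 ((b, inl j) : gT * bunch)); apply: leq_sum => -[a [i|h]] _ //=.
  case: eqP => //; rewrite {1}Ex => /sc_hook_inj[-> ->].
  by rewrite eqxx.
rewrite [X in _ + X]big1 ?addn0 // => -[a [i|h]] _ //.
by have /= -> := not_hook (a, i).
Qed.

(* [K] is the induced subgraph of [hang] in which the connecting vertex and the
   copy of [H i] are kept exactly at the hooks [(a, i)] with [B a i].  It is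
   used for [hang] itself and for what a deletion leaves apart from [H i]. *)
Section Part.

Variables (B : gT -> 'I_k -> bool) (K : sgraph) (iota : K -> hang).
Hypothesis iota_emb : embedding iota.
Hypothesis iota_present : forall x, present B (iota x).
Hypothesis iota_onto : forall y, present B y -> exists x, iota x = y.

Lemma part_conn : connected K.
Proof.
have [i_inj i_adj] := iota_emb.
(* [kap] places the scaffold, which is always present, inside [K]. *)
have [kap kapE] := fin_all_exists (fun x : S => @iota_onto (inl x) isT).
move=> P Padj.
have PS x y : P (kap x) = P (kap y).
  apply: (sc_conn (P := fun x => P (kap x))) => {}x {}y xy.
  by apply: Padj; rewrite -i_adj !kapE.
have P_root a i (r : K) : iota r = inr (a, inl i) -> P r = P (kap (sc_hook S a i)).
  by move=> Er; apply: Padj; rewrite -i_adj Er kapE /= eqxx.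
suff Pk x : exists y, P x = P (kap y).
  by move=> x y; have [[x' ->] [y' ->]] := (Pk x, Pk y).
case Ex: (iota x) => [y|[a [i|[i h]]]].
- by exists y; congr P; apply: i_inj; rewrite Ex kapE.
- by exists (sc_hook S a i); apply: P_root.
have Bai : B a i by have := iota_present x; rewrite Ex.
have [r Er] := @iota_onto (inr (a, inl i)) Bai.
have [pen penE] := fin_all_exists (fun h : H i =>
    @iota_onto (inr (a, inr (Tagged H h))) Bai).
exists (sc_hook S a i); rewrite -(P_root _ _ _ Er).
have ->: x = pen h by apply: i_inj; rewrite penE Ex.
have -> : P (pen h) = P (pen (root i)).
  apply: (@H_conn i (fun h => P (pen h))) => h1 h2 h12.
  by apply: Padj; rewrite -i_adj !penE /= !eqxx tagged_asE.
by apply: Padj; rewrite -i_adj penE Er /= !eqxx.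
Qed.

(** High degree is found only in the scaffold, and low scaffold vertices have a high neighbour
    there, so [f] preserves the scaffold and acts on it as some [g]. Connecting vertices follow
    their hooks, copies follow by connectedness, and [root_rigid] leaves no freedom inside a
    copy. *)
Lemma part_emb_act (f : K -> K) : embedding f ->
  exists g, forall x, iota (f x) = hang_act g (iota x).
Proof.
move=> fE; have [f_inj f_adj] := fE; have [i_inj i_adj] := iota_emb.
have [kap kapE] := fin_all_exists (fun x : S => @iota_onto (inl x) isT).
have kap_emb : embedding kap.
  by split=> [x y /(congr1 iota)|x y]; rewrite -?i_adj !kapE // => -[].
have highS x : sc_deg S <= deg x -> exists2 u : S, iota x = inl u & sc_deg S <= deg u.
  move=> high_x; have := leq_trans high_x (leq_deg x iota_emb).
  case: (iota x) => [u|[a z]]; last by rewrite leqNgt deg_bunch.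
  move=> high_u; exists u => //; rewrite leqNgt; apply/negP => /deg_scaffold.
  by rewrite ltnNge high_u.
have f_high (u : S) : sc_deg S <= deg u ->
    exists2 u' : S, iota (f (kap u)) = inl u' & sc_deg S <= deg u'.
  by move=> high_u; apply: highS; rewrite deg_embedding // (leq_trans high_u) // leq_deg.
have f_S (x : S) : exists x' : S, f (kap x) = kap x'.
  suff [x' Ex'] : exists x' : S, iota (f (kap x)) = inl x'.
    by exists x'; apply: i_inj; rewrite kapE.
  have [low_x|/f_high[x' ? _]] := ltnP (deg x) (sc_deg S); last by exists x'.
  have [y xy /f_high[y' Ey' high_y']] := sc_low_near low_x.
  have : adj (iota (f (kap x))) (iota (f (kap y))) by rewrite i_adj f_adj kap_emb.2.
  case: (iota (f (kap x))) => [x'|[a [i|h]]]; rewrite Ey' //; first by exists x'.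
  move=> /eqP Eh; move: high_y'; rewrite Eh leqNgt (ltn_trans _ (sc_hook_low S a i)) //.
have [s sE] := fin_all_exists f_S.
have s_emb : embedding s.
  split=> [x y xy|x y]; last by rewrite -kap_emb.2 -!sE f_adj kap_emb.2.
  by apply/kap_emb.1/f_inj; rewrite !sE xy.
(* [s] permutes the scaffold, so the injective [f] sends nothing else into it. *)
have notS x a z : iota x = inr (a, z) -> exists bw, iota (f x) = inr bw.
  move=> Ex; case Efx: (iota (f x)) => [y|bw]; last by exists bw.
  have [s' _ s'K] := injF_bij s_emb.1.
  have Exy : x = kap (s' y) by apply/f_inj/i_inj; rewrite sE kapE s'K.
  by move: Ex; rewrite Exy kapE.
have [g sg] := sc_emb_act s_emb; exists g => x.
have fS y : iota (f (kap y)) = inl (sc_act g y) by rewrite sE kapE sg.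
have f_root r a i : iota r = inr (a, inl i) -> iota (f r) = inr ((g * a)%g, inl i).
  move=> Er; have [bw Efr] := notS _ _ _ Er.
  have: adj (iota (f (kap (sc_hook S a i)))) (iota (f r)).
    by rewrite i_adj f_adj -i_adj kapE Er /= eqxx.
  rewrite fS Efr sc_act_hook; case: bw {Efr} => b [j|h] //= /eqP/sc_hook_inj.
  by case=> <- <-.
case Ex: (iota x) => [y|[a [i|[i h]]]] /=; last 1 first.
- have Bai : B a i by have := iota_present x; rewrite Ex.
  have [r Er] := @iota_onto (inr (a, inl i)) Bai.
  have [pen penE] := fin_all_exists (fun h : H i =>
    @iota_onto (inr (a, inr (Tagged H h))) Bai).
  have {Ex}->: x = pen h by apply: i_inj; rewrite penE Ex.
  have Efr := f_root _ _ _ Er.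
  pose inH y := if iota y is inr (b, inr h) then (b == (g * a)%g) && (tag h == i) else false.
  have inH_root : inH (f (pen (root i))).
    have: adj (iota (f r)) (iota (f (pen (root i)))).
      by rewrite i_adj f_adj -i_adj penE Er /= !eqxx.
    have [bw E] := notS _ _ _ (penE (root i)).
    rewrite /inH E Efr; case: bw {E} => b [j|h'] /=; first by rewrite andbF.
    by case/andP=> /eqP<- /eqP->; rewrite !eqxx.
  have inHP h' : inH (f (pen h')).
    suff -> : inH (f (pen h')) = inH (f (pen (root i))) by [].
    apply: (@H_conn i (fun h => inH (f (pen h)))) => h1 h2 h12.
    (* An edge could leave the copy only to its connecting vertex, which is already the image of
       [r]. *)
    have half h3 h4 : adj h3 h4 -> inH (f (pen h3)) -> inH (f (pen h4)).
      move=> h34; have [bw E] := notS _ _ _ (penE h4).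
      have: adj (iota (f (pen h3))) (iota (f (pen h4))).
        by rewrite i_adj f_adj -i_adj !penE /= !eqxx tagged_asE.
      rewrite /inH E; case: (iota (f (pen h3))) => // -[b [//|[j3 h3']]].
      case: bw E => c [j4|[j4 h4']] E /= /andP[/eqP-> ].
        move/eqP/(congr1 tag)=> /= Ej /andP[/eqP Ec /eqP Ei]; subst.
        suff: iota (f (pen h4)) = iota (f r).
          by move/i_inj/f_inj/(congr1 iota); rewrite penE Er.
        by rewrite E Efr.
      by case/andP=> /eqP /= jj _; rewrite jj.
    by apply/idP/idP; apply: half; rewrite // adj_sym.
  have /fin_all_exists[t tE] h' : exists h'' : H i,
      iota (f (pen h')) = inr ((g * a)%g, inr (Tagged H h'')).
    move: (inHP h'); rewrite /inH; case: (iota _) => // -[b [//|[j h'']]].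
    by case/andP=> /eqP-> /= /eqP Ej; subst j; exists h''.
  suff t_id : t =1 id by rewrite tE t_id.
  have Tag_inj : injective (fun h : H i => Tagged H h).
    by move=> h1 h2 /eqP; rewrite eq_Tagged => /eqP.
  apply: root_rigid.
    split=> [h1 h2 h12|h1 h2].
      have: f (pen h1) = f (pen h2) by apply: i_inj; rewrite !tE h12.
      by move/f_inj/(congr1 iota); rewrite !penE => -[] /Tag_inj.
    have := f_adj (pen h1) (pen h2).
    by rewrite -!i_adj !tE !penE /= !eqxx !tagged_asE.
  (* [t] fixes the root, the only vertex of the copy adjacent to the connecting vertex. *)
  have: adj (iota (f r)) (iota (f (pen (root i)))).
    by rewrite i_adj f_adj -i_adj penE Er /= !eqxx.
  by rewrite Efr tE /= eqxx => /eqP /Tag_inj.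
- have ->: x = kap y by apply: i_inj; rewrite kapE.
  by rewrite fS.
exact: f_root.
Qed.

End Part.

(** * Deleting the connecting vertex of a hook *)

Section Delete.

Variable i : 'I_k.

Definition rest_present (y : hang) : bool :=
  present (fun a j => (a, j) != (1%g, i)) y.

Definition rest_adj : rel {y | rest_present y} := fun x y => adj (val x) (val y).

Lemma rest_adj_sym : symmetric rest_adj.
Proof. by move=> x y; apply: adj_sym. Qed.

Lemma rest_adj_irrefl : irreflexive rest_adj.
Proof. by move=> x; apply: adj_irrefl. Qed.

Definition rest := SGraph rest_adj_sym rest_adj_irrefl.

Lemma rest_val_emb : embedding (val : rest -> hang).
Proof. by split=> //; apply: val_inj. Qed.

Lemma rest_val_onto y : rest_present y -> exists x : rest, val x = y.
Proof. by move=> y_rest; exists (exist rest_present y y_rest). Qed.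

Lemma rest_conn : connected rest.
Proof. exact: part_conn rest_val_emb (fun x => valP x) rest_val_onto. Qed.

(** An embedding acts as some [g]; if [g] were not [1], it would move the connecting vertex of
    [(g^-1, i)], which is kept, to that of [(1, i)], which is gone. *)
Lemma rest_rigid : rigid rest.
Proof.
move=> f fE x; apply: val_inj.
have [g gP] := part_emb_act rest_val_emb (fun x => valP x) rest_val_onto fE.
suff g1 : g = 1%g.
  rewrite gP g1; case: (val x) => [y|[a z]] /=; rewrite ?mul1g //.
  by congr inl; apply: (sc_act_emb S 1%g).1; rewrite -sc_actM mulg1.
apply/eqP; apply: contraT => g_neq1.
have g_rest : rest_present (inr (g^-1%g, inl i)).
  by rewrite /= xpair_eqE eqxx andbT invg_eq1.
have [r Er] := rest_val_onto g_rest.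
by have := valP (f r); rewrite gP Er /= mulgV /rest_present /= eqxx.
Qed.

(** The scaffold alone is large enough: a neighbour of a hook has degree at least [sc_deg S], which
    exceeds the total size of the hung graphs. *)
Lemma card_rest : #|H i| < #|rest|.
Proof.
apply: (@leq_ltn_trans #|{: {i : 'I_k & H i}}|).
  rewrite -(card_codom (f := fun x : H i => Tagged H x)) ?max_card // => x y /eqP.
  by rewrite eq_Tagged => /eqP.
apply: (@leq_trans (sc_deg S)).
  by apply: leq_trans deg_big; rewrite ltnS ltnW // ltnS leq_addl.
have [] := @sc_low_near _ _ S (sc_hook S 1%g i); first exact: ltn_trans (sc_hook_low S 1%g i).
move=> y _ high_y; apply: leq_trans high_y _.
apply: (@leq_trans #|S|).
  by rewrite -[leqRHS]sum1_card; apply: leq_sum => x _; apply: leq_b1.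
pose j (x : S) : rest := exist rest_present (inl x) isT.
by rewrite -(card_codom (f := j)) ?max_card // => x x' /(congr1 val)[].
Qed.

(** The deleted vertex was the only link between this copy of [H i] and all else. *)
Lemma splits_hang : splits rest (H i) (del_vertex (inr (1%g, inl i) : hang)).
Proof.
pose emb (u : rest + H i) : hang :=
  match u with inl x => val x | inr h => inr (1%g, inr (Tagged H h)) end.
have embP u : emb u != inr (1%g, inl i).
  case: u => [x|h]; last by apply/eqP.
  by apply: contraTneq (valP x); rewrite /emb => ->; rewrite /rest_present /= eqxx.
have Tag_inj : injective (fun h : H i => Tagged H h).
  by move=> h1 h2 /eqP; rewrite eq_Tagged => /eqP.
have notrest (h : H i) : ~~ rest_present (inr (1%g, inr (Tagged H h))).
  by rewrite /rest_present /= eqxx.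
have emb_inj : injective emb.
  move=> [x|h] [y|h'] //=.
  - by move/val_inj->.
  - by move=> E; case/negP: (notrest h'); rewrite -E; apply: valP.
  - by move=> E; case/negP: (notrest h); rewrite E; apply: valP.
  - by case=> /Tag_inj->.
have cross (x : rest) (h : H i) : adj (val x) (emb (inr h)) = false.
  case: x => [[y|[a [j|[j h']]]]] //=; rewrite /rest_present /=;
    case: (a =P 1%g) => //= ->; rewrite xpair_eqE eqxx /=.
    move=> ji; apply: contraNF ji => /eqP/(congr1 tag) /= ij; exact/eqP.
  by move/negbTE->.
pose phi u := exist (fun y => y != inr (1%g, inl i) :> hang) _ (embP u).
exists phi; split; last first.
  case=> [x|h] [y|h'] //; rewrite /= /del_adj.
  - exact: cross.
  - exact: etrans (@adj_sym hang _ _) (cross y h).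
  - by rewrite /= !eqxx tagged_asE.
apply: inj_card_bij => [u v /(congr1 val)/emb_inj //|].
rewrite -[leqRHS](card_codom (f := phi)); last by move=> u v /(congr1 val)/emb_inj.
apply/subset_leq_card/subsetP => -[y y_neq] _.
suff [u Eu] : exists u, emb u = y.
  by apply/codomP; exists u; apply: val_inj; rewrite /= Eu.
have [y_rest|] := boolP (rest_present y).
  by exists (inl (exist rest_present y y_rest)).
case: y y_neq => [//|[a [j|[j h]]]] /= y_neq; rewrite /rest_present /= negbK.
  by move/eqP=> [Ea Ej]; case/eqP: y_neq; rewrite Ea Ej.
by case/eqP=> Ea Ej; subst; exists (inr h).
Qed.

End Delete.

(** * The whole graph before any deletion *)

Lemma hang_id_emb : embedding (id : hang -> hang).
Proof. by split=> // x y. Qed.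

Lemma present_all y : present (fun _ _ => true) y.
Proof. by case: y => // -[a []]. Qed.

Lemma hang_id_onto y : present (fun _ _ => true) y -> exists x : hang, id x = y.
Proof. by exists y. Qed.

Lemma hang_conn : connected hang.
Proof. exact: part_conn hang_id_emb present_all hang_id_onto. Qed.

Lemma hang_emb_act (f : hang -> hang) : embedding f -> exists g, f =1 hang_act g.
Proof. exact: (part_emb_act hang_id_emb present_all hang_id_onto). Qed.

Lemma hang_act_free (i : 'I_k) g :
  hang_act g (inl (sc_hook S 1%g i)) = inl (sc_hook S 1%g i) -> g = 1%g.
Proof. by case; rewrite sc_act_hook mulg1 => /sc_hook_inj[]. Qed.

(** Provides the root by which this graph is hung in the next induction step. *)
Lemma hang_rigid_at (i : 'I_k) : rigid_at (inl (sc_hook S 1%g i) : hang).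
Proof.
move=> f fE; have [g fg] := hang_emb_act fE; rewrite fg => /hang_act_free g1 y.
rewrite fg g1; case: y => [x|[a z]] /=; rewrite ?mul1g //.
by congr inl; apply: (sc_act_emb S 1%g).1; rewrite -sc_actM mulg1.
Qed.

Lemma hang_aut (i : 'I_k) : graph_aut hang \isog [set: gT].
Proof.
exact: graph_aut_isog hang_act_emb hang_actM hang_emb_act (@hang_act_free i).
Qed.

End Hanging.

(** * Induction on the number of rounds *)

Section Strategy.

Variables (k : nat) (Gamma : 'I_k -> finGroupType).

Definition strategic (gT : finGroupType) (l : nat) (G : sgraph) :=
  [/\ graph_aut G \isog [set: gT], connected G, exists v : G, rigid_at v &
      winning Gamma l G].

(** The groups of the [H i] matter only for the winning clause, so the base case can hang one-vertex
    graphs. *)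
Lemma strategic_hang (gT : finGroupType) (l : nat) (H : 'I_k -> sgraph) :
  0 < k -> (forall i, connected (H i)) -> (forall i, exists v : H i, rigid_at v) ->
  exists G, [/\ graph_aut G \isog [set: gT], connected G, exists v : G, rigid_at v &
    (forall i, strategic (Gamma i) l (H i)) -> winning Gamma l.+1 G].
Proof.
move=> k_gt0 Hconn /fin_all_exists[root root_rigid].
have [S deg_big] := scaffold_exists gT k (k + #|{: {i : 'I_k & H i}}|).+2.
pose i0 := Ordinal k_gt0; exists (hang S root); split.
- exact: hang_aut i0.
- exact: hang_conn.
- by exists (inl (sc_hook S 1%g i0)); apply: hang_rigid_at.
move=> Hs i; have [Hi _ _ Hw] := Hs i; exists (inr (1%g, inl i)).
  rewrite -(isog_transl _ (splits_graph_aut (splits_hang S root i) _ _ _)) //.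
  - exact: rest_conn.
  - exact: rest_rigid.
  - exact: card_rest.
apply: splits_winning (splits_hang S root i) _ Hw.
- exact: rest_conn.
- exact: rest_rigid.
- exact: card_rest.
Qed.

Lemma strategic_exists (l : nat) : 0 < k ->
  forall gT : finGroupType, exists G, strategic gT l G.
Proof.
move=> k_gt0; elim: l => [|l IHl] gT.
  pose K1 := @SGraph unit (fun _ _ => false) (fun _ _ => erefl) (fun _ => erefl).
  have [||G [? ? ? _]] := @strategic_hang gT 0 (fun=> K1) k_gt0; last by exists G.
    by move=> _ P _ [] [].
  by move=> _; exists tt => f _ _ []; case: (f tt).
have /fin_all_exists[H HP] i := IHl (Gamma i).
have [||G [? ? ? Gw]] := @strategic_hang gT l H k_gt0.
- by move=> i; have [] := HP i.
- by move=> i; have [] := HP i.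
by exists G; split=> //; apply: Gw.
Qed.

End Strategy.

Theorem mainTheorem1 (k l : nat) (hk : 0 < k) (hl : 0 < l)
    (Gamma0 : finGroupType) (Gamma : 'I_k -> finGroupType) :
  exists G0 : sgraph,
    graph_aut G0 \isog [set: Gamma0] /\
    rounds l G0 (fun h : seq ('I_k * sgraph) =>
      all (fun p => graph_aut p.2 \isog [set: Gamma p.1]) h).
Proof.
have [G [G_aut _ _ /winning_rounds Gw]] := strategic_exists Gamma l hk Gamma0.
by exists G.
Qed.
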